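(* Let $G$ be a finite simple graph on $n$ vertices. Then \begin{align*} d_{n-3}(G) &= \binom{n}{3} -\Bigl(i(G)\binom{n-1}{2}+\ell(G)(n-2)+n_2(G)\Bigr)\\ &\quad+\Bigl(\binom{i(G)}{2}(n-2)+i(G)\ell(G)+e_2(G)(n-2)+s(G)+m(G)+t_{22}(G)\Bigr)\\ &\quad-\Bigl(\binom{i(G)}{3}+i(G)e_2(G)+p_3(G)+c_3(G)\Bigr), \end{align*} where $i(G)$ is the number of isolated vertices, $\ell(G)$ is the number of leaves (vertices of degree $1$), $n_2(G)$ is the number of vertices of degree $2$, $e_2(G)$ is the number of connected components isomorphic to $K_2$, $s(G)$ is the number of unordered pairs of leaves with a common neighbor, $m(G)$ is the number of edges joining a leaf to a vertex of degree $2$, $t_{22}(G)$ is the number of unordered pairs of degree-$2$ vertices with equal closed neighborhoods, $p_3(G)$ is the number of connected components isomorphic to the path $P_3$ on three vertices, and $c_3(G)$ is the number of connected components isomorphic to $K_3$.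
   Context: A set $S\subseteq V(G)$ is dominating if every vertex of $G$ is in $S$ or adjacent to a vertex of $S$. For an integer $k$, $d_k(G)$ denotes the number of dominating sets of $G$ of size exactly $k$. The closed neighborhood $N[v]$ of a vertex $v$ is $v$ together with all its neighbors. Binomial coefficients $\binom{a}{b}$ are $0$ when $b<0$ or $b>a$. *)

(* Defs.v *)
From mathcomp Require Import all_boot all_order all_algebra.

Set Implicit Arguments.
Unset Strict Implicit.
Unset Printing Implicit Defensive.

Record sgraph := SGraph {
  vertex :> finType;
  adj : rel vertex;
  adj_sym : symmetric adj;
  adj_irrefl : irreflexive adj
}.

Definition isom (G H : sgraph) : bool :=
  [exists f : {ffun G -> H}, exists g : {ffun H -> G},
    [&& [forall x, g (f x) == x], [forall y, f (g y) == y]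
      & [forall x, forall y, adj (f x) (f y) == adj x y]]].

Definition complete_rel k : rel 'I_k := fun x y => x != y.

Lemma complete_sym k : symmetric (@complete_rel k).
Proof. by move=> x y; rewrite /complete_rel eq_sym. Qed.

Lemma complete_irrefl k : irreflexive (@complete_rel k).
Proof. by move=> x; rewrite /complete_rel eqxx. Qed.

Definition complete k : sgraph :=
  SGraph (@complete_sym k) (@complete_irrefl k).

(* The path on k vertices 0 - 1 - ... - (k - 1). *)
Definition path_rel k : rel 'I_k :=
  fun x y => (x.+1 == y :> nat) || (y.+1 == x :> nat).

Lemma path_sym k : symmetric (@path_rel k).
Proof. by move=> x y; rewrite /path_rel orbC. Qed.

Lemma path_irrefl k : irreflexive (@path_rel k).
Proof. by move=> x; rewrite /path_rel orbb eqn_leq ltnn. Qed.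

Definition path_graph k : sgraph := SGraph (@path_sym k) (@path_irrefl k).

Section Graph.
Variable G : sgraph.
Implicit Types (x y v : G) (S C : {set G}).

Definition nbhd v : {set G} := [set w | adj v w].
Definition cl_nbhd v : {set G} := v |: nbhd v.
Definition deg v : nat := #|nbhd v|.

Definition edges : {set {set G}} :=
  [set E | [exists x, exists y, adj x y && (E == [set x; y])]].

Definition dominating S : bool :=
  [forall v, (v \in S) || [exists w in S, adj v w]].

(* The size k is an integer, so that d_(n-3) makes sense (and is 0) for n < 3. *)
Definition dom_count (k : int) : nat :=
  #|[set S : {set G} | dominating S && (Posz #|S| == k)]|.

Definition induced_rel C : rel {x | x \in C} :=
  fun u w => adj (val u) (val w).

Lemma induced_sym C : symmetric (@induced_rel C).
Proof. by move=> x y; exact: adj_sym. Qed.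

Lemma induced_irrefl C : irreflexive (@induced_rel C).
Proof. by move=> x; exact: adj_irrefl. Qed.

Definition induced C : sgraph := SGraph (@induced_sym C) (@induced_irrefl C).

Definition components : {set {set G}} :=
  [set [set y | connect (@adj G) x y] | x : G].

Definition component_count (H : sgraph) : nat :=
  #|[set C in components | isom (induced C) H]|.

Definition isolated v : bool := deg v == 0.
Definition leaf v : bool := deg v == 1.

Definition isolated_count : nat := #|[set v | isolated v]|.
Definition leaf_count : nat := #|[set v | leaf v]|.
Definition deg2_count : nat := #|[set v | deg v == 2]|.

(* Unordered pairs of distinct vertices are represented as two-element sets. *)
Definition leaf_pair_count : nat :=
  #|[set P : {set G} | [exists x, exists y,
      [&& x != y, P == [set x; y], leaf x, leaf y
        & [exists w, adj x w && adj y w]]]]|.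

Definition leaf_deg2_edge_count : nat :=
  #|[set E in edges | [exists x, exists y,
      [&& E == [set x; y], leaf x & deg y == 2]]]|.

Definition deg2_twin_count : nat :=
  #|[set P : {set G} | [exists x, exists y,
      [&& x != y, P == [set x; y], deg x == 2, deg y == 2
        & cl_nbhd x == cl_nbhd y]]]|.

End Graph.

(* Main.v *)
Require Import Defs.
From mathcomp Require Import all_boot all_order all_algebra.
From mathcomp Require Import zify.

(** A set S of n - 3 vertices is dominating iff its complement T, a triple,
    contains no closed neighborhood.  Let b(T) <= 3 be the number of vertices v
    with N[v] included in T.  Since [b = 0] + b + C(b, 3) = 1 + C(b, 2) for
    b <= 3, double counting reduces the theorem to summing, over the vertex sets
    A of size 1, 2 and 3, the number of triples containing N[A].  This number
    depends only on |N[A]| and vanishes when |N[A]| > 3, which leaves few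
    configurations; for |A| = 3 it is 1 exactly when A is a union of
    components. *)

Set Implicit Arguments.
Unset Strict Implicit.
Unset Printing Implicit Defensive.

(** * Supersets of a given size; sets with two or three elements *)

Section FiniteSets.
Variable T : finType.
Implicit Types (x y : T) (A B P : {set T}).

(** Adding [B] is a bijection from the subsets of [~: B] with [k - #|B|] elements. The hypothesis
    keeps the truncated subtraction exact: for [k < #|B|] the binomial would be 1 although no set
    qualifies. *)
Lemma card_supersets B k : #|B| <= k ->
  #|[set A : {set T} | B \subset A & #|A| == k]| = 'C(#|T| - #|B|, k - #|B|).
Proof.
move=> leBk; rewrite -(cardsC B) addKn -cards_draws.
have disjB A : A \subset ~: B -> [disjoint B & A].
  by rewrite -disjoints_subset disjoint_sym.
rewrite -[RHS](card_in_imset (f := fun A => B :|: A)); last first.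
  move=> A A1; rewrite !inE => /andP[+ _] /andP[+ _] /=.
  move=> /disjB dA /disjB dA1 eqU.
  have cancelU (C : {set T}) : [disjoint B & C] -> (B :|: C) :\: B = C.
    move=> dC; rewrite setDUl setDv set0U; apply/setDidPl.
    by rewrite disjoint_sym.
  by rewrite -(cancelU A dA) eqU cancelU.
apply: eq_card => A; rewrite inE; apply/andP/imsetP => [[sBA /eqP cA]|].
  exists (A :\: B); last by rewrite setDE setUIr setUCr setIT; apply/esym/setUidPr.
  by rewrite inE subsetDr cardsD (setIidPr sBA) cA eqxx.
case=> C; rewrite inE => /andP[/disjB dC /eqP cC] ->; rewrite subsetUl.
move: dC; rewrite -setI_eq0 => /eqP dC; split=> //.
by rewrite cardsU dC cards0 subn0 cC subnKC.
Qed.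

Lemma eq_set2 x y x' y' : x != y -> [set x; y] = [set x'; y'] ->
  (x' = x /\ y' = y) \/ (x' = y /\ y' = x).
Proof.
move=> nxy E; have: x \in [set x'; y'] by rewrite -E set21.
have: y \in [set x'; y'] by rewrite -E set22.
rewrite !inE => /orP[] /eqP ? /orP[] /eqP ?; subst; rewrite ?eqxx // in nxy *; auto.
Qed.

(** Statistics of unordered pairs are defined by such existentials; once the elements are named,
    only the two labellings of the pair remain. *)
Lemma exists_set2E (R : rel T) x y : x != y ->
  [exists x', exists y', ([set x; y] == [set x'; y']) && R x' y'] =
  R x y || R y x.
Proof.
move=> nxy; apply/existsP/orP => [[x' /existsP[y' /andP[/eqP E Rxy]]]|[] Rxy].
- by case: (eq_set2 nxy E) => -[? ?]; subst; auto.
- by exists x; apply/existsP; exists y; rewrite eqxx.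
- by exists y; apply/existsP; exists x; rewrite setUC eqxx.
Qed.

Lemma cards3P P : reflect
  (exists x y z, [/\ x != y, y != z, x != z & P = [set x; y; z]]) (#|P| == 3).
Proof.
apply: (iffP idP) => [cP|[x [y [z [nxy nyz nxz ->]]]]]; last first.
  by rewrite setUC cardsU1 !inE cards2 nxy negb_or ![z == _]eq_sym nxz nyz.
have [x xP] : exists x, x \in P by apply/card_gt0P; rewrite (eqP cP).
have /cards2P[y [z [nyz eP]]] : #|P :\ x| == 2.
  by move: cP; rewrite (cardsD1 x) xP.
exists x, y, z; have := setD11 x P; rewrite eP !inE => /negbT.
rewrite negb_or => /andP[-> ->]; split=> //.
by rewrite -setUA -eP setD1K.
Qed.

(** Disjointness makes the ordered pair recoverable from [P]: its first component is the element
    lying in [A]. *)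
Lemma card_set2_setX A B : [disjoint A & B] ->
  #|[set P | [exists x, exists y, [&& x != y, P == [set x; y] & (x \in A) && (y \in B)]]]|
  = #|A| * #|B|.
Proof.
move=> dAB; have neAB x y : x \in A -> y \in B -> x != y.
  by move=> xA yB; apply: contraTneq yB => <-; rewrite (disjointFr dAB).
rewrite -cardsX -[RHS](card_in_imset (f := fun u => [set u.1; u.2])).
  apply: eq_card => P; rewrite inE; apply/existsP/imsetP.
    move=> [x /existsP[y /and3P[_ /eqP-> xyAB]]]; exists (x, y) => //.
    by rewrite inE.
  move=> [[x y]]; rewrite inE /= => /andP[xA yB] ->; exists x; apply/existsP; exists y.
  by rewrite eqxx neAB // xA yB.
move=> [x y] [x' y']; rewrite !inE /= => /andP[xA yB] /andP[xA' yB'] E.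
case: (eq_set2 (neAB _ _ xA yB) E) => -[ex ey]; first by rewrite ex ey.
by rewrite ey (disjointFr dAB xA) in yB'.
Qed.

End FiniteSets.

(** * Isomorphism of an induced subgraph with a given graph *)

Section InducedIsomorphism.
Variables (G H : sgraph) (C : {set G}).

(** Trades two inverse maps on the subtype of vertices of [C] for one embedding of [H] into [G], so
    that later arguments handle vertices of [G] only. *)
Lemma isom_inducedP :
  reflect (exists h : H -> G, [/\ injective h, C = [set h i | i : H]
                               & forall i j, adj (h i) (h j) = adj i j])
          (isom (induced C) H).
Proof.
apply: (iffP existsP) => [[f /existsP[g /and3P[/forallP fK /forallP gK]]]|].
  move=> /forallP fadj; exists (fun i => val (g i)); split.
  - by move=> i j /val_inj E; rewrite -(eqP (gK i)) E (eqP (gK j)).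
  - apply/setP => x; apply/idP/imsetP => [xC|[i _ ->]]; last exact: valP.
    by exists (f (Sub x xC)); rewrite // (eqP (fK _)).
  - move=> i j; have /forallP/(_ (g j))/eqP := fadj (g i).
    by rewrite (eqP (gK i)) (eqP (gK j)) => ->.
case=> h [h_inj hC hadj].
have hin i : h i \in C by rewrite hC imset_f.
have inv (x : {x | x \in C}) : exists i, h i == val x.
  have /imsetP[i _ E] : val x \in [set h i | i : H] by rewrite -hC; exact: (valP x).
  by exists i; rewrite E.
exists [ffun x => xchoose (inv x)]; apply/existsP.
exists [ffun i => exist (fun x => x \in C) (h i) (hin i)].
have invK x : h (xchoose (inv x)) = val x by apply/eqP; apply: (xchooseP (inv x)).
apply/and3P; split; apply/forallP => x.
- by rewrite !ffunE; apply/eqP/val_inj => /=; rewrite invK.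
- by rewrite !ffunE; apply/eqP/h_inj; rewrite invK.
- by apply/forallP => y; rewrite !ffunE -hadj !invK.
Qed.

End InducedIsomorphism.

(** * Closed sets and components isomorphic to K_2, P_3 or K_3 *)

Section Components.
Variable G : sgraph.
Implicit Types (x y z v : G) (A C P : {set G}).

Lemma adj_neq x y : adj x y -> x != y.
Proof. by apply: contraTneq => ->; rewrite adj_irrefl. Qed.

(** The closed sets are exactly the unions of connected components. *)
Definition closed_set A := [forall (v | v \in A), cl_nbhd v \subset A].

Lemma closed_setP A :
  reflect (forall v w, v \in A -> adj v w -> w \in A) (closed_set A).
Proof.
apply: (iffP forall_inP) => [cA v w /cA/subsetP sA vw|cA v vA].
  by apply: sA; rewrite !inE vw orbT.
by apply/subsetP => w; rewrite !inE => /predU1P[->//|]; apply: cA.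
Qed.

Lemma closed_component C : C \in components G -> closed_set C.
Proof.
case/imsetP => x _ ->; apply/closed_setP => v w; rewrite !inE => xv vw.
exact: connect_trans xv (connect1 vw).
Qed.

(** A walk starting in a closed set never leaves it, so the component of [x] lies inside [C]; the
    last hypothesis gives the other inclusion. *)
Lemma closed_connected_component x C : closed_set C -> x \in C ->
  {subset C <= connect (@adj G) x} -> C \in components G.
Proof.
move=> /closed_setP cC xC conC; apply/imsetP; exists x => //; apply/setP => y.
rewrite inE; apply/idP/idP => [/conC//|/connectP[p]].
elim: p x xC {conC} => [|z p IHp] x xC /=; first by move=> _ ->.
by case/andP=> /(cC _ _ xC); exact: IHp.
Qed.

Lemma component_K2P C : reflect
  (exists x y, [/\ closed_set C, C = [set x; y] & adj x y])
  ((C \in components G) && isom (induced C) (complete 2)).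
Proof.
have I2 (i : 'I_2) : i = ord0 \/ i = ord_max.
  by case: i => [[|[|[]]] lti] //; [left|right]; apply/val_inj.
apply: (iffP andP) => [[compC /isom_inducedP[h [_ hC hadj]]]|].
  exists (h ord0), (h ord_max); split; last by rewrite hadj.
    exact: closed_component.
  apply/setP => x; rewrite hC !inE; apply/imsetP/orP => [[i _ ->]|[] /eqP->].
  - by case: (I2 i) => ->; rewrite eqxx; [left|right].
  - by exists ord0.
  - by exists ord_max.
move=> [x [y [cC defC xy]]]; split.
  apply: (@closed_connected_component x) => //; first by rewrite defC set21.
  by move=> z; rewrite defC !inE => /orP[] /eqP->; [exact: connect0|exact: connect1].
have nxy : x != y := adj_neq xy.
apply/isom_inducedP; exists (fun i : 'I_2 => if i == ord0 then x else y); split.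
- move=> i j; case: (I2 i) => ->; case: (I2 j) => -> //= E; rewrite E eqxx // in nxy.
- apply/setP => z; rewrite defC !inE; apply/orP/imsetP => [[] /eqP->|[i _ ->]].
  + by exists ord0.
  + by exists ord_max.
  + by case: (I2 i) => ->; rewrite eqxx; [left|right].
- move=> i j; case: (I2 i) => ->; case: (I2 j) => -> //=;
    by rewrite ?adj_irrefl ?xy // adj_sym.
Qed.

(** Serves P_3 and K_3 at once: with the edges 01 and 12 present, a graph on three vertices is
    connected and is determined by whether 0 and 2 are adjacent. *)
Lemma component_order3P C (r : rel 'I_3) (r_sym : symmetric r)
    (r_irr : irreflexive r) (i0 := @ord0 2) (i1 := @Ordinal 3 1 isT)
    (i2 := @Ordinal 3 2 isT) : r i0 i1 -> r i1 i2 ->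
  reflect (exists x y z, [/\ closed_set C, C = [set x; y; z], x != z,
                             adj x y && adj y z & adj x z = r i0 i2])
    ((C \in components G) && isom (induced C) (SGraph r_sym r_irr)).
Proof.
move=> r01 r12; have I3 (i : 'I_3) : [\/ i = i0, i = i1 | i = i2].
  by case: i => [[|[|[|[]]]] lti] //; [apply: Or31|apply: Or32|apply: Or33];
     apply/val_inj.
apply: (iffP andP) => [[compC /isom_inducedP[h [h_inj hC hadj]]]|].
  exists (h i0), (h i1), (h i2); rewrite !hadj /= r01 r12 inj_eq //; split=> //.
    exact: closed_component.
  apply/setP => x; rewrite hC !inE -orbA; apply/imsetP/or3P => [[i _ ->]|].
    by case: (I3 i) => ->; rewrite eqxx; [apply: Or31|apply: Or32|apply: Or33].
  by case=> /eqP->; [exists i0|exists i1|exists i2].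
move=> [x [y [z [cC defC nxz /andP[xy yz] xz]]]]; split.
  apply: (@closed_connected_component x) => //; first by rewrite defC !inE eqxx.
  move=> w; rewrite defC !inE -orbA => /or3P[] /eqP->.
  - exact: connect0.
  - exact: connect1.
  - exact: connect_trans (connect1 xy) (connect1 yz).
have nxy : x != y := adj_neq xy.
have nyz : y != z := adj_neq yz.
pose h i := if i == i0 then x else if i == i1 then y else z.
apply/isom_inducedP; exists h; split.
- move=> i j; case: (I3 i) => ->; case: (I3 j) => -> //; rewrite /h /= => /eqP;
    by rewrite ?(negPf nxy) ?(negPf nyz) ?(negPf nxz) 1?eq_sym
       ?(negPf nxy) ?(negPf nyz) ?(negPf nxz).
- apply/setP => w; rewrite defC !inE -orbA; apply/or3P/imsetP => [|[i _ ->]].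
    by case=> /eqP->; [exists i0|exists i1|exists i2].
  by case: (I3 i) => ->; rewrite /h /= eqxx; [apply: Or31|apply: Or32|apply: Or33].
- move=> i j; case: (I3 i) => ->; case: (I3 j) => -> //; rewrite /h /=;
    rewrite ?adj_irrefl ?r_irr ?xy ?yz ?xz ?r01 ?r12 //;
    by rewrite adj_sym r_sym ?xy ?yz ?xz ?r01 ?r12.
Qed.

Lemma component_P3P C : reflect
  (exists x y z, [/\ closed_set C, C = [set x; y; z], x != z,
                     adj x y && adj y z & adj x z = false])
  ((C \in components G) && isom (induced C) (path_graph 3)).
Proof. exact: component_order3P. Qed.

Lemma component_K3P C : reflect
  (exists x y z, [/\ closed_set C, C = [set x; y; z], x != z,
                     adj x y && adj y z & adj x z = true])
  ((C \in components G) && isom (induced C) (complete 3)).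
Proof. exact: component_order3P. Qed.

End Components.

(** * Cardinalities as sums of indicators *)

Lemma sum_nat_of_bool (T : finType) (Q P : pred T) :
  \sum_(x | Q x) (P x : nat) = #|[set x | Q x && P x]|.
Proof.
by rewrite -sum1dep_card [RHS]big_mkcondr; apply: eq_bigr => x _; case: (P x).
Qed.

Lemma sum_mem_set (T : finType) (Q : pred T) (S : {set T}) :
  {subset S <= Q} -> \sum_(x | Q x) (x \in S : nat) = #|S|.
Proof.
move=> sSQ; rewrite sum_nat_of_bool; apply: eq_card => x; rewrite inE.
by case xS: (x \in S); rewrite ?andbF ?andbT //; exact: sSQ.
Qed.

(** Brings the pair statistics under a common sum over two-element sets, where they can be compared
    one pair at a time. *)
Lemma sum_exists_set2 (T : finType) (R : rel T) :
  \sum_(A : {set T} | #|A| == 2)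
     ([exists x, exists y, (A == [set x; y]) && R x y] : nat) =
  #|[set A : {set T} | [exists x, exists y, [&& x != y, A == [set x; y] & R x y]]]|.
Proof.
rewrite sum_nat_of_bool; apply: eq_card => A; rewrite !inE.
apply/andP/existsP => [[cA /existsP[x /existsP[y /andP[/eqP eA Rxy]]]]|].
  exists x; apply/existsP; exists y; rewrite Rxy eA eqxx !andbT.
  by rewrite eA cards2 in cA; case: (x != y) cA.
case=> x /existsP[y /and3P[nxy /eqP-> Rxy]]; rewrite cards2 nxy; split=> //.
by apply/existsP; exists x; apply/existsP; exists y; rewrite eqxx.
Qed.

(** * Double counting of triples that contain closed neighborhoods *)

Section Counting.
Variable G : sgraph.
Implicit Types (x y z v w : G) (A C P Q S T U : {set G}).

Let n := #|G|.

Definition cl_nbhd_set A : {set G} := \bigcup_(v in A) cl_nbhd v.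

(** The set whose cardinality is b(T). *)
Definition enclosed T : {set G} := [set v | cl_nbhd v \subset T].

Definition triples_above U : nat := #|[set T : {set G} | U \subset T & #|T| == 3]|.

(** The case [#|U| > 3] is separate because the truncated [3 - #|U|] would give the binomial 1
    instead of 0. *)
Lemma triples_aboveE U :
  triples_above U = if #|U| <= 3 then 'C(n - #|U|, 3 - #|U|) else 0.
Proof.
case: leqP => [/card_supersets //|ltU].
apply/eqP; rewrite cards_eq0 -subset0; apply/subsetP => T; rewrite inE.
by case/andP=> /subset_leq_card leUT /eqP cT; rewrite cT leqNgt ltU in leUT.
Qed.

Lemma cl_nbhd_refl v : v \in cl_nbhd v.
Proof. exact: setU11. Qed.

Lemma in_cl_nbhd v w : (w \in cl_nbhd v) = (w == v) || adj v w.
Proof. by rewrite !inE. Qed.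

Lemma card_cl_nbhd v : #|cl_nbhd v| = (deg v).+1.
Proof. by rewrite cardsU1 inE adj_irrefl. Qed.

Lemma cl_nbhd_set_sub A T : (cl_nbhd_set A \subset T) = (A \subset enclosed T).
Proof.
apply/bigcupsP/subsetP => sA v vA; first by rewrite inE sA.
by have := sA v vA; rewrite inE.
Qed.

Lemma sub_cl_nbhd_set A : A \subset cl_nbhd_set A.
Proof. by apply/subsetP => v vA; apply/bigcupP; exists v; rewrite ?cl_nbhd_refl. Qed.

Lemma enclosed_sub T : enclosed T \subset T.
Proof.
by apply/subsetP => v; rewrite inE => /subsetP; apply; exact: cl_nbhd_refl.
Qed.

Lemma closed_cl_nbhd_set A : closed_set A = (cl_nbhd_set A \subset A).
Proof. by apply/forall_inP/bigcupsP. Qed.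

(** Both sides count the pairs (A, T) of sets of sizes k and 3 with N[A] included in T, equivalently
    with A included in [enclosed T]. *)
Lemma sum_bin_enclosed k :
  \sum_(T : {set G} | #|T| == 3) 'C(#|enclosed T|, k) =
  \sum_(A : {set G} | #|A| == k) triples_above (cl_nbhd_set A).
Proof.
transitivity (\sum_(T : {set G} | #|T| == 3) \sum_(A : {set G} | #|A| == k)
                (cl_nbhd_set A \subset T : nat)).
  apply: eq_bigr => T _; rewrite sum_nat_of_bool -cards_draws; apply: eq_card => A.
  by rewrite !inE cl_nbhd_set_sub andbC.
rewrite exchange_big; apply: eq_bigr => A _; rewrite sum_nat_of_bool.
by apply: eq_card => T; rewrite !inE andbC.
Qed.

(** The case k = 1 of the same double count, with vertices in place of singletons. *)
Lemma sum_card_enclosed :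
  \sum_(T : {set G} | #|T| == 3) #|enclosed T| = \sum_v triples_above (cl_nbhd v).
Proof.
transitivity (\sum_(T : {set G} | #|T| == 3) \sum_v (cl_nbhd v \subset T : nat)).
  by apply: eq_bigr => T _; rewrite sum_nat_of_bool.
rewrite exchange_big; apply: eq_bigr => v _; rewrite sum_nat_of_bool.
by apply: eq_card => T; rewrite !inE andbC.
Qed.

Lemma dominating_setC T : dominating (~: T) = (#|enclosed T| == 0).
Proof.
rewrite cards_eq0; apply/forallP/eqP => [domT|encT0 v].
  apply/setP => v; rewrite !inE; apply/negP => /subsetP sT.
  case/orP: (domT v) => [|/existsP[w /andP[]]]; rewrite inE.
    by rewrite sT ?cl_nbhd_refl.
  by move=> wT vw; rewrite sT // in_cl_nbhd vw orbT in wT.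
have : v \notin enclosed T by rewrite encT0 inE.
rewrite inE => /subsetPn[w]; rewrite in_cl_nbhd => /predU1P[->|vw] wT.
  by rewrite inE wT.
by apply/orP; right; apply/existsP; exists w; rewrite inE wT.
Qed.

(** Complementation is a bijection between the two families. Sizes are compared in [int], so n < 3
    needs no separate treatment. *)
Lemma dom_count_enclosed :
  dom_count G (n%:Z - 3)%R =
  \sum_(T : {set G} | #|T| == 3) (#|enclosed T| == 0 : nat).
Proof.
rewrite sum_nat_of_bool /dom_count -(card_imset _ (@setC_inj G)).
apply: eq_card => T; rewrite inE; apply/imsetP/andP => [[S]|[cT encT]].
  rewrite inE => /andP[domS /eqP cS] ->; rewrite -dominating_setC setCK.
  split=> //; rewrite -eqz_nat; apply/eqP.
  have := cardsC S; rewrite -/n => /(congr1 Posz); rewrite PoszD cS => H.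
  by apply: (GRing.addrI (n%:Z - 3)%R); rewrite H GRing.subrK.
exists (~: T); last by rewrite setCK.
rewrite inE dominating_setC encT /=; apply/eqP.
by rewrite /n -(cardsC T) PoszD (eqP cT) GRing.addrAC GRing.addrN GRing.add0r.
Qed.

Lemma inclusion_exclusion :
  dom_count G (n%:Z - 3)%R + \sum_v triples_above (cl_nbhd v)
    + \sum_(A : {set G} | #|A| == 3) triples_above (cl_nbhd_set A) =
  'C(n, 3) + \sum_(A : {set G} | #|A| == 2) triples_above (cl_nbhd_set A).
Proof.
rewrite -!sum_bin_enclosed -sum_card_enclosed dom_count_enclosed.
have -> : 'C(n, 3) = \sum_(T : {set G} | #|T| == 3) 1.
  by rewrite sum1dep_card card_draws.
rewrite -!big_split; apply: eq_bigr => T /eqP cT /=.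
(* The bound b(T) <= 3 is essential: the identity checked next fails at b = 4. *)
have := subset_leq_card (enclosed_sub T); rewrite cT.
by case: #|enclosed T| => [|[|[|[|]]]].
Qed.

(** * Contribution of single vertices *)

Lemma sum_triples_above1 :
  \sum_v triples_above (cl_nbhd v) =
  isolated_count G * 'C(n.-1, 2) + leaf_count G * (n - 2) + deg2_count G.
Proof.
rewrite /isolated_count /leaf_count /deg2_count.
rewrite -!(sum_nat_of_bool predT) !big_distrl -!big_split; apply: eq_bigr => v _ /=.
(* Degrees 0, 1 and 2 contribute C(n-1, 2), n - 2 and 1; larger degrees contribute 0. *)
rewrite triples_aboveE card_cl_nbhd /isolated /leaf.
case: (deg v) => [|[|[|d]]] //=; rewrite ?subn1 ?subSS ?subn0 ?bin1 ?bin0 ?mul0n ?mul1n ?addn0 //.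
Qed.

(** * Contribution of pairs of vertices *)

Lemma cl_nbhd_set2 x y : cl_nbhd_set [set x; y] = cl_nbhd x :|: cl_nbhd y.
Proof.
apply/setP => z; apply/bigcupP/setUP => [[w]|].
  by rewrite !inE => /orP[] /eqP->; auto.
by case=> z_in; [exists x|exists y]; rewrite // !inE eqxx ?orbT.
Qed.

Lemma isolated_adj x y : isolated x -> adj x y = false.
Proof.
by rewrite /isolated cards_eq0 => /eqP/setP/(_ y); rewrite !inE.
Qed.

Lemma isolated_neq v x y : isolated v -> adj x y -> v != x.
Proof. by move=> iv; apply: contraTneq => <-; rewrite isolated_adj. Qed.

Lemma leaf_adj x y z : leaf x -> adj x y -> adj x z = (z == y).
Proof.
move=> /cards1P[w /setP N]; have := N y; have := N z.
by rewrite !inE => -> -> /eqP->.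
Qed.

(** If x and y are not adjacent, closedness leaves neither of them a possible neighbor. The two
    alternatives are isolated pairs and K_2 components. *)
Lemma closed_set2 x y : x != y -> closed_set [set x; y] =
  isolated x && isolated y || adj x y && closed_set [set x; y].
Proof.
move=> nxy; apply/idP/orP => [cP|[/andP[ix iy]|/andP[]//]]; last first.
  apply/closed_setP => v w; rewrite !inE.
  by case/orP=> /eqP->; rewrite isolated_adj.
have [xy|nadj] := boolP (adj x y); [by right|left].
have sub v w : v \in [set x; y] -> adj v w -> w \in [set x; y] := closed_setP _ cP v w.
rewrite /isolated !cards_eq0 -!subset0; apply/andP; split; apply/subsetP => w;
  rewrite !inE => vw.
- have := sub x w; rewrite !inE eqxx => /(_ isT vw) /orP[] /eqP E.
    by rewrite E adj_irrefl in vw.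
  by rewrite E (negPf nadj) in vw.
- have := sub y w; rewrite !inE eqxx orbT => /(_ isT vw) /orP[] /eqP E.
    by rewrite E adj_sym (negPf nadj) in vw.
  by rewrite E adj_irrefl in vw.
Qed.

Lemma card_cl_nbhd_set2_eq2 x y : x != y ->
  (#|cl_nbhd x :|: cl_nbhd y| == 2) = closed_set [set x; y].
Proof.
move=> nxy; have := sub_cl_nbhd_set [set x; y]; rewrite closed_cl_nbhd_set cl_nbhd_set2.
move=> sPU; have := subset_leq_card sPU; rewrite cards2 nxy => ltU.
transitivity ([set x; y] == cl_nbhd x :|: cl_nbhd y).
  by rewrite eqEcard sPU cards2 nxy eqn_leq ltU andbT.
by rewrite eqEsubset sPU.
Qed.

Definition common_nbhd x y := [exists w, adj x w && adj y w].

(** A union of three vertices forces both degrees to be at most 2. The summands belong to the degree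
    pairs {0,1}, {1,1}, {1,2} and {2,2}, so at most one of them is nonzero. *)
Lemma card_cl_nbhd_set2_eq3 x y : x != y ->
  (#|cl_nbhd x :|: cl_nbhd y| == 3 : nat) =
    (isolated x && leaf y || isolated y && leaf x)
    + [&& leaf x, leaf y & common_nbhd x y]
    + (adj x y && (leaf x && (deg y == 2) || leaf y && (deg x == 2)))
    + [&& deg x == 2, deg y == 2 & cl_nbhd x == cl_nbhd y].
Proof.
have common_sym u v : common_nbhd u v = common_nbhd v u.
  by apply: eq_existsb => w; rewrite andbC.
(* Both sides are symmetric in [x] and [y]. *)
wlog le_deg : x y / deg x <= deg y => [IH nxy|nxy].
  case/orP: (leq_total (deg x) (deg y)) => le_deg; first exact: IH.
  have nyx : y != x by rewrite eq_sym.
  rewrite setUC (IH y x) // common_sym adj_sym [cl_nbhd y == _]eq_sym.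
  by case: (isolated x) (isolated y) (leaf x) (leaf y) (deg x == 2) (deg y == 2)
    => [] [] [] [] [] [].
have cU := cardsUI (cl_nbhd x) (cl_nbhd y).
have leU : #|cl_nbhd y| <= #|cl_nbhd x :|: cl_nbhd y|.
  by apply: subset_leq_card; rewrite subsetUr.
have leI : #|cl_nbhd x :&: cl_nbhd y| <= #|cl_nbhd x|.
  by apply: subset_leq_card; rewrite subsetIl.
rewrite !card_cl_nbhd in cU leU leI.
(* N[y] already has three elements, so N[x] must add none. *)
have cardU3 : deg y = 2 -> (#|cl_nbhd x :|: cl_nbhd y| == 3) = (cl_nbhd x \subset cl_nbhd y).
  move=> dy2; rewrite dy2 in leU; rewrite eqn_leq leU andbT.
  have := eqEcard (cl_nbhd y) (cl_nbhd x :|: cl_nbhd y).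
  rewrite subsetUr card_cl_nbhd dy2 /= => <-.
  by rewrite eq_sym; apply/eqP/setUidPr.
have xNx := cl_nbhd_refl x; have yNy := cl_nbhd_refl y.
have xNy : (x \in cl_nbhd y) = adj x y by rewrite in_cl_nbhd (negPf nxy) adj_sym.
(* If deg y >= 3, N[y] alone has at least four elements, and every summand vanishes. *)
have [dy3|] := leqP 3 (deg y).
  rewrite /isolated /leaf; case: eqP; first by lia.
  by case: (deg y) dy3 => [|[|[|d]]] // _ _; rewrite !andbF.
have [dx0|dx0] := posnP (deg x).
  have Nx : cl_nbhd x = [set x].
    by apply/esym/eqP; rewrite eqEcard sub1set xNx cards1 card_cl_nbhd dx0.
  have ix : isolated x by rewrite /isolated dx0.
  rewrite Nx cardsU1 xNy isolated_adj // card_cl_nbhd.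
  by rewrite /isolated /leaf dx0; case: (deg y) => [|[|[|d]]].
move=> dy2; have [dx1|dx1] := eqVneq (deg x) 1.
  have lx : leaf x by rewrite /leaf dx1.
  have [dy1|dy1] := eqVneq (deg y) 1.
    have ly : leaf y by rewrite /leaf dy1.
    rewrite dx1 dy1 in cU leU leI *; rewrite /isolated lx ly dx1 dy1 /= !andbF !addn0.
    (* Two sets of size 2 have a union of size 3 iff they meet in one element. *)
    have -> : (#|cl_nbhd x :|: cl_nbhd y| == 3) = (#|cl_nbhd x :&: cl_nbhd y| == 1).
      by apply/eqP/eqP; lia.
    congr nat_of_bool; apply/cards1P/existsP => [[z Iz]|[u /andP[xu yu]]].
      have zI v : (v \in cl_nbhd x) && (v \in cl_nbhd y) = (v == z).
        by rewrite -in_setI Iz inE.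
      (* Adjacent [x] and [y] would both lie in the one-element intersection. *)
      have nadj : adj x y = false.
        apply: contraNF nxy => xy; have := zI x; have := zI y.
        by rewrite xNx yNy xNy in_cl_nbhd xy orbT => /esym/eqP-> /esym/eqP->.
      have := zI z; rewrite eqxx !in_cl_nbhd => /andP[/predU1P[->|xz] /predU1P[E|yz]].
      + by rewrite E eqxx in nxy.
      + by rewrite adj_sym nadj in yz.
      + by rewrite E nadj in xz.
      + by exists z; rewrite xz.
    exists u; apply/setP => z; rewrite in_setI !in_cl_nbhd in_set1.
    rewrite (leaf_adj _ lx xu) (leaf_adj _ ly yu).
    by case: (z == u); rewrite ?orbT ?orbF //; case: eqP => // ->; rewrite (negPf nxy).
  have {}dy2 : deg y = 2 by lia.
  rewrite /isolated lx /leaf dx1 dy2 /= addn0 andbT.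
  (* Inclusion puts x in N[y]; conversely, adjacency makes N[x] = {x, y}. *)
  rewrite cardU3 //; congr nat_of_bool; apply/idP/idP => [/subsetP sub|xy].
    by rewrite -xNy sub.
  apply/subsetP => z; rewrite in_cl_nbhd (leaf_adj _ lx xy).
  by case/orP=> /eqP->; rewrite ?xNy.
have {}dx2 : deg x = 2 by lia.
have {}dy2 : deg y = 2 by lia.
rewrite /isolated /leaf dx2 dy2 /= andbF /= add0n.
by rewrite cardU3 // eqEcard !card_cl_nbhd dx2 dy2 leqnn andbT.
Qed.

(** Gives the count the shape that [sum_exists_set2] handles, with [adj x y] replacing membership in
    [edges]. *)
Lemma leaf_deg2_edge_countE : leaf_deg2_edge_count G =
  #|[set A : {set G} | [exists x, exists y,
       [&& x != y, A == [set x; y] & adj x y && (leaf x && (deg y == 2))]]]|.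
Proof.
apply: eq_card => A; rewrite !inE; apply/andP/existsP.
  move=> [/existsP[u /existsP[v /andP[uv /eqP eA]]] /existsP[x /existsP[y]]].
  move=> /and3P[/eqP eA' lx dy]; exists x; apply/existsP; exists y.
  have nuv : u != v := adj_neq uv.
  rewrite eA' eqxx lx dy /= andbT; rewrite eA in eA'.
  case: (eq_set2 nuv eA') => -[-> ->]; first by rewrite uv nuv.
  by rewrite adj_sym uv eq_sym nuv.
move=> [x /existsP[y /and3P[_ eA /and3P[xy lx dy]]]].
by split; apply/existsP; exists x; apply/existsP; exists y; rewrite eA ?xy ?lx.
Qed.

Lemma component_count_K2E : component_count G (complete 2) =
  #|[set A : {set G} | [exists x, exists y,
       [&& x != y, A == [set x; y] & adj x y && closed_set [set x; y]]]]|.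
Proof.
apply: eq_card => A; rewrite !inE; apply/component_K2P/existsP.
  move=> [x [y [cA eA xy]]]; exists x; apply/existsP; exists y.
  rewrite eA eqxx xy -eA cA !andbT.
  exact: adj_neq xy.
move=> [x /existsP[y /and3P[_ /eqP eA /andP[xy cA]]]].
by exists x, y; rewrite eA.
Qed.

Lemma sum_triples_above2 :
  \sum_(A : {set G} | #|A| == 2) triples_above (cl_nbhd_set A) =
  'C(isolated_count G, 2) * (n - 2) + isolated_count G * leaf_count G
  + component_count G (complete 2) * (n - 2)
  + leaf_pair_count G + leaf_deg2_edge_count G + deg2_twin_count G.
Proof.
pose Iso := [set v : G | isolated v]; pose Leaf := [set v : G | leaf v].
have disjIL : [disjoint Iso & Leaf].
  rewrite -setI_eq0; apply/eqP/setP => v; rewrite !inE /isolated /leaf.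
  by case: (deg v) => [|[]].
have -> : 'C(isolated_count G, 2) =
    \sum_(A : {set G} | #|A| == 2) (A \subset Iso : nat).
  rewrite sum_nat_of_bool -cards_draws; apply: eq_card => A.
  by rewrite !inE andbC.
have -> : isolated_count G * leaf_count G = #|Iso| * #|Leaf| by [].
rewrite -(card_set2_setX disjIL) component_count_K2E leaf_deg2_edge_countE.
rewrite /leaf_pair_count /deg2_twin_count.
rewrite -(sum_exists_set2 (fun x y => (x \in Iso) && (y \in Leaf))).
rewrite -(sum_exists_set2 (fun x y => adj x y && closed_set [set x; y])).
rewrite -(sum_exists_set2 (fun x y => [&& leaf x, leaf y & common_nbhd x y])).
rewrite -(sum_exists_set2 (fun x y => adj x y && (leaf x && (deg y == 2)))).
rewrite -(sum_exists_set2
  (fun x y : G => [&& deg x == 2, deg y == 2 & cl_nbhd x == cl_nbhd y])).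
rewrite !big_distrl -!big_split; apply: eq_bigr => A /cards2P[x [y [nxy ->]]] /=.
rewrite !exists_set2E // !inE subUset !sub1set !inE.
rewrite [adj y x]adj_sym [[set y; x]]setUC orbb.
have -> : [&& leaf x, leaf y & common_nbhd x y] || [&& leaf y, leaf x & common_nbhd y x]
    = [&& leaf x, leaf y & common_nbhd x y].
  have -> : common_nbhd y x = common_nbhd x y by apply: eq_existsb => w; rewrite andbC.
  by case: (leaf x) (leaf y) => [] []; rewrite ?orbb.
rewrite [cl_nbhd y == _]eq_sym.
rewrite [[&& deg y == 2, _ & _]]andbCA orbb -andb_orr.
rewrite cl_nbhd_set2.
(* The union contains [x] and [y], so sizes 0 and 1 do not occur. *)
have -> : triples_above (cl_nbhd x :|: cl_nbhd y) =
    (#|cl_nbhd x :|: cl_nbhd y| == 2) * (n - 2) + (#|cl_nbhd x :|: cl_nbhd y| == 3).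
  have := subset_leq_card (sub_cl_nbhd_set [set x; y]).
  rewrite cards2 nxy cl_nbhd_set2 triples_aboveE.
  case: #|_| => [|[|[|[|u]]]] //= _; rewrite ?subSS ?subn0 ?bin1 ?bin0; lia.
rewrite card_cl_nbhd_set2_eq2 // card_cl_nbhd_set2_eq3 // closed_set2 //.
(* The alternatives of [closed_set2] exclude each other, since an isolated x has no neighbor; the
   disjunction thus becomes a sum. *)
have [ix|_] /= := boolP (isolated x).
  rewrite isolated_adj // /leaf (eqP ix) /=.
  by case: (isolated y); case: (deg y == 1); lia.
by rewrite [adj x y && (adj x y && _)]andbA andbb mul0n add0n !addnA [_ * _ + _]addnC.
Qed.

(** * Contribution of triples of vertices *)

(* For closed triples the value of this sum, which does not depend on a labelling
   of the triple, is 0, 2, 4 or 6 according to the type of the components. *)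
Definition degree_sum_in A := \sum_(u in A) \sum_(w in A) adj u w.

Lemma degree_sum_in_set3 x y z : x != y -> y != z -> x != z ->
  degree_sum_in [set x; y; z] = (adj x y + adj y z + adj x z).*2.
Proof.
move=> nxy nyz nxz; have sum3 (F : G -> nat) :
    \sum_(u in [set x; y; z]) F u = F x + F y + F z.
  rewrite -setUA big_setU1 ?inE ?negb_or ?nxy //= big_setU1 ?inE //= big_set1.
  by rewrite addnA.
rewrite /degree_sum_in sum3 !sum3 !adj_irrefl.
rewrite [adj y x]adj_sym [adj z y]adj_sym [adj z x]adj_sym.
by case: (adj x y) (adj y z) (adj x z) => [] [] [].
Qed.

Lemma closed_set_isolated A : (forall v, v \in A -> isolated v) -> closed_set A.
Proof. by move=> isoA; apply/closed_setP => v w /isoA iv; rewrite isolated_adj. Qed.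

Definition isolated_set : {set G} := [set v | isolated v].
Definition components_iso (H : sgraph) : {set {set G}} :=
  [set C in components G | isom (induced C) H].
Definition isolated_K2_unions : {set {set G}} :=
  [set u.1 |: u.2 | u in setX isolated_set (components_iso (complete 2))].

(** The pair is recovered from its union: v is the isolated part and C is the rest. *)
Lemma card_isolated_K2_unions :
  #|isolated_K2_unions| = isolated_count G * component_count G (complete 2).
Proof.
rewrite card_in_imset ?cardsX // => -[v C] [v' C']; rewrite !inE /=.
move=> /andP[iv /component_K2P[x [y [_ -> xy]]]].
move=> /andP[iv' /component_K2P[x' [y' [_ -> xy']]]] E.
have nonisolated (a b : G) : adj a b -> ~~ isolated a && ~~ isolated b.
  move=> ab; rewrite -negb_or; apply: contraTN ab.
  by case/orP=> i0; [|rewrite adj_sym]; rewrite isolated_adj.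
have eqI (w a b : G) : isolated w -> adj a b ->
    (w |: [set a; b]) :&: isolated_set = [set w] /\
    (w |: [set a; b]) :\: isolated_set = [set a; b].
  move=> iw /nonisolated/andP[ia ib]; split; apply/setP => u; rewrite !inE;
    have [->|_] := eqVneq u w; rewrite ?iw //=.
  - by case: eqP => [->|_]; [rewrite (negPf ia)|case: eqP => [->|//]; rewrite (negPf ib)].
  - by rewrite (_ : [|| _ | _] = false) //; apply/norP; split;
      [apply: contraNneq ia => <-|apply: contraNneq ib => <-].
  - by case: eqP => [->|_]; [rewrite (negPf ia)|case: eqP => [->|]; rewrite ?(negPf ib) ?andbF].
have [I1 D1] := eqI _ _ _ iv xy; have [I2 D2] := eqI _ _ _ iv' xy'.
by rewrite -D1 -D2 E; congr pair; apply/set1_inj; rewrite -I1 -I2 E.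
Qed.

(** A graph on three vertices is determined up to isomorphism by its number k of edges, so a
    labelling can make the edges fill xy, yz, xz in this order. *)
Lemma three_set_adj_label A k : #|A| == 3 -> degree_sum_in A = k.*2 ->
  exists x y z, [/\ [/\ x != y, y != z & x != z], A = [set x; y; z]
    & [/\ adj x y = (0 < k), adj y z = (1 < k) & adj x z = (2 < k)]].
Proof.
case/cards3P=> x [y [z [nxy nyz nxz eA]]]; rewrite {1}eA degree_sum_in_set3 //.
move=> /double_inj kE.
have rot1 : [set x; y; z] = [set y; z; x] by rewrite -setUA setUC.
have rot2 : [set x; y; z] = [set z; x; y] by rewrite rot1 -setUA setUC.
have nyx : y != x by rewrite eq_sym.
have nzx : z != x by rewrite eq_sym.
have nzy : z != y by rewrite eq_sym.
have label (u v w : G) : [set x; y; z] = [set u; v; w] -> u != v -> v != w -> u != w ->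
    adj u v = (0 < k) -> adj v w = (1 < k) -> adj u w = (2 < k) ->
  exists x y z, [/\ [/\ x != y, y != z & x != z], A = [set x; y; z]
    & [/\ adj x y = (0 < k), adj y z = (1 < k) & adj x z = (2 < k)]].
  by move=> eA' *; exists u, v, w; rewrite eA.
(* Cyclic rotations suffice: they bring the only edge first, or the only missing edge last. *)
move: (label x y z erefl) (label y z x rot1) (label z x y rot2) => {label}.
rewrite [adj z x]adj_sym [adj y x]adj_sym [adj z y]adj_sym -kE.
by case: (adj x y) (adj y z) (adj x z) => [] [] [] lab1 lab2 lab3;
  first [exact: lab1 | exact: lab2 | exact: lab3].
Qed.

(** In a closed set, every edge at a vertex of [A] stays inside [A], so the sum sees it. *)
Lemma degree_sum_isolated A : closed_set A ->
  (A \subset isolated_set) = (degree_sum_in A == 0).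
Proof.
move=> /closed_setP cA; rewrite sum_nat_eq0; apply/subsetP/forall_inP => isoA u uA.
  rewrite sum_nat_eq0; apply/forall_inP => w _.
  by have := isoA u uA; rewrite inE => iu; rewrite isolated_adj.
rewrite inE /isolated cards_eq0 -subset0; apply/subsetP => w; rewrite !inE => uw.
have := isoA u uA; rewrite sum_nat_eq0 => /forall_inP/(_ w (cA u w uA uw)).
by rewrite uw.
Qed.

(** The value 2 means a single edge inside [A]; closedness makes its ends a K_2 component and
    isolates the third vertex. *)
Lemma isolated_K2_union_degree_sum A : closed_set A -> #|A| == 3 ->
  (A \in isolated_K2_unions) = (degree_sum_in A == 2).
Proof.
move=> cA cardA; apply/imsetP/eqP => [[[v C]]|/(@three_set_adj_label A 1 cardA)].
  rewrite !inE /= => /andP[iv /component_K2P[x [y [_ -> xy]]]] eA.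
  have neqv u w : adj u w -> v != u := isolated_neq iv.
  have nxy : x != y := adj_neq xy.
  have nvx := neqv _ _ xy; have nvy : v != y by apply: (neqv y x); rewrite adj_sym.
  by rewrite eA setUA degree_sum_in_set3 // !(isolated_adj _ iv) xy.
move=> [x [y [z [[nxy nyz nxz] eA [/= xy yz xz]]]]]; rewrite eA in cA.
have sub := closed_setP _ cA.
exists (z, [set x; y]); last by rewrite eA setUC.
rewrite !inE; apply/andP; split=> /=.
  rewrite /isolated cards_eq0 -subset0; apply/subsetP => w; rewrite !inE => zw.
  have := sub z w; rewrite !inE eqxx !orbT => /(_ isT zw); rewrite -orbA.
  by case/or3P=> /eqP ew; rewrite ew ?adj_irrefl // adj_sym ?yz ?xz in zw.
apply/component_K2P; exists x, y; split=> //; apply/closed_setP => u w.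
rewrite !inE => /orP[] /eqP-> uw.
  by have := sub x w; rewrite !inE eqxx => /(_ isT uw)/orP[//|/eqP ew]; rewrite ew xz in uw.
have := sub y w; rewrite !inE eqxx orbT => /(_ isT uw)/orP[//|/eqP ew].
by rewrite ew yz in uw.
Qed.

Lemma adj2_neq x y z : adj x y && adj y z -> x != y /\ y != z.
Proof.
by move=> /andP[/adj_neq nxy /adj_neq nyz].
Qed.

(** The value 4 means two edges; on three vertices they share an end and form a path. *)
Lemma component_P3_degree_sum A : closed_set A -> #|A| == 3 ->
  (A \in components_iso (path_graph 3)) = (degree_sum_in A == 4).
Proof.
move=> cA cardA; rewrite inE; apply/component_P3P/eqP.
  move=> [x [y [z [_ -> nxz xyz xz]]]]; have [nxy nyz] := adj2_neq xyz.
  by rewrite degree_sum_in_set3 //; case/andP: xyz => -> ->; rewrite xz.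
case/(@three_set_adj_label A 2 cardA) => x [y [z [[_ _ nxz] eA [xy yz xz]]]].
by exists x, y, z; rewrite xy yz.
Qed.

Lemma component_K3_degree_sum A : closed_set A -> #|A| == 3 ->
  (A \in components_iso (complete 3)) = (degree_sum_in A == 6).
Proof.
move=> cA cardA; rewrite inE; apply/component_K3P/eqP.
  move=> [x [y [z [_ -> nxz xyz xz]]]]; have [nxy nyz] := adj2_neq xyz.
  by rewrite degree_sum_in_set3 //; case/andP: xyz => -> ->; rewrite xz.
case/(@three_set_adj_label A 3 cardA) => x [y [z [[_ _ nxz] eA [xy yz xz]]]].
by exists x, y, z; rewrite xy yz.
Qed.

Lemma isolated_K2_unionP A : A \in isolated_K2_unions -> closed_set A /\ #|A| = 3.
Proof.
case/imsetP=> [[v C]]; rewrite !inE /= => /andP[iv /component_K2P[x [y [cC eC xy]]]] ->; subst C.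
split; last first.
  have neqv u w : adj u w -> v != u := isolated_neq iv.
  have nxy : x != y := adj_neq xy.
  rewrite cardsU1 cards2 nxy !inE negb_or (neqv x y) //.
  by rewrite (neqv y x) // adj_sym.
move: cC => /closed_setP cC; apply/closed_setP => u w.
rewrite ![_ \in v |: _]in_setU1.
case/predU1P=> [->|uC uw]; first by rewrite (isolated_adj _ iv).
by rewrite (cC u w uC uw) orbT.
Qed.

Lemma component_order3_card A (b : bool) :
  (exists x y z, [/\ closed_set A, A = [set x; y; z], x != z,
                     adj x y && adj y z & adj x z = b]) ->
  closed_set A /\ #|A| == 3.
Proof.
move=> [x [y [z [cA eA nxz xyz _]]]]; have [nxy nyz] := adj2_neq xyz.
by split=> //; apply/cards3P; exists x, y, z.
Qed.

Lemma sum_triples_above3 :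
  \sum_(A : {set G} | #|A| == 3) triples_above (cl_nbhd_set A) =
  'C(isolated_count G, 3) + isolated_count G * component_count G (complete 2)
  + component_count G (path_graph 3) + component_count G (complete 3).
Proof.
(* Each family consists of closed triples, so its cardinality is a sum over all triples whose terms
   vanish off the closed ones. *)
have memK2 A : A \in isolated_K2_unions -> closed_set A /\ #|A| == 3.
  by case/isolated_K2_unionP=> cA ->.
have memP3 A : A \in components_iso (path_graph 3) -> closed_set A /\ #|A| == 3.
  by rewrite inE => /component_P3P/component_order3_card.
have memK3 A : A \in components_iso (complete 3) -> closed_set A /\ #|A| == 3.
  by rewrite inE => /component_K3P/component_order3_card.
have -> : 'C(isolated_count G, 3) =
    \sum_(A : {set G} | #|A| == 3) (A \subset isolated_set : nat).
  rewrite sum_nat_of_bool -cards_draws; apply: eq_card => A.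
  by rewrite !inE andbC.
rewrite -card_isolated_K2_unions.
rewrite -(sum_mem_set (Q := fun A => #|A| == 3) (fun A mA => proj2 (memK2 A mA))).
rewrite -[component_count G (path_graph 3)](sum_mem_set (Q := fun A => #|A| == 3)
  (fun A mA => proj2 (memP3 A mA))).
rewrite -[component_count G (complete 3)](sum_mem_set (Q := fun A => #|A| == 3)
  (fun A mA => proj2 (memK3 A mA))).
rewrite -!big_split; apply: eq_bigr => A cardA /=.
(* Since A lies in N[A], the only triple that can contain N[A] is A itself. *)
have -> : triples_above (cl_nbhd_set A) = closed_set A.
  rewrite closed_cl_nbhd_set; have sAN := sub_cl_nbhd_set A.
  have [sNA|] := boolP (cl_nbhd_set A \subset A).
    have -> : cl_nbhd_set A = A by apply/eqP; rewrite eqEsubset sNA.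
    by rewrite triples_aboveE (eqP cardA) subnn bin0.
  rewrite triples_aboveE; case: leqP => // leN /negP[].
  have : A == cl_nbhd_set A by rewrite eqEcard sAN (eqP cardA).
  by move/eqP=> <-.
have [cA|ncA] := boolP (closed_set A); last first.
  rewrite (contraNF (fun mA => proj1 (memK2 A mA)) ncA).
  rewrite (contraNF (fun mA => proj1 (memP3 A mA)) ncA).
  rewrite (contraNF (fun mA => proj1 (memK3 A mA)) ncA).
  case: subsetP => // isoA; case/negP: ncA; apply: closed_set_isolated => v.
  by move/isoA; rewrite inE.
(* A closed triple spans 0, 1, 2 or 3 edges, and exactly one of the four indicators is 1. *)
rewrite degree_sum_isolated // isolated_K2_union_degree_sum //.
rewrite component_P3_degree_sum // component_K3_degree_sum //.
have /cards3P[x [y [z [nxy nyz nxz ->]]]] := cardA.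
rewrite degree_sum_in_set3 //.
by case: (adj x y) (adj y z) (adj x z) => [] [] [].
Qed.

(** * The formula over naturals, and its transfer to integers *)

Lemma dom_count_nat :
  dom_count G (n%:Z - 3)%R
  + (isolated_count G * 'C(n.-1, 2) + leaf_count G * (n - 2) + deg2_count G)
  + ('C(isolated_count G, 3) + isolated_count G * component_count G (complete 2)
     + component_count G (path_graph 3) + component_count G (complete 3)) =
  'C(n, 3)
  + ('C(isolated_count G, 2) * (n - 2) + isolated_count G * leaf_count G
     + component_count G (complete 2) * (n - 2)
     + leaf_pair_count G + leaf_deg2_edge_count G + deg2_twin_count G).
Proof.
by rewrite -sum_triples_above1 -sum_triples_above2 -sum_triples_above3
           inclusion_exclusion.
Qed.

Lemma leaf_order v : leaf v -> 1 < n.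
Proof.
by move=> lv; rewrite -(eqP lv : deg v = 1) -card_cl_nbhd max_card.
Qed.

(** This lemma and the next two show that each coefficient of n - 2 vanishes when n < 2, where the
    truncated difference departs from the integer one. *)
Lemma leaf_count_order : leaf_count G = 0 \/ 1 < n.
Proof.
have [->|/card_gt0P[v lv]] := posnP (leaf_count G); [by left|right].
by apply: (@leaf_order v); rewrite inE in lv.
Qed.

Lemma component_K2_order : component_count G (complete 2) = 0 \/ 1 < n.
Proof.
have [->|/card_gt0P[A]] := posnP (component_count G (complete 2)); first by left.
rewrite inE => /component_K2P[x [y [_ _ xy]]].
have nxy : x != y := adj_neq xy.
by right; have := max_card [set x; y]; rewrite cards2 nxy.
Qed.

Lemma isolated_pairs_order : 'C(isolated_count G, 2) = 0 \/ 1 < n.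
Proof.
have [ltI|leI] := ltnP (isolated_count G) 2; first by left; exact: bin_small.
by right; apply: leq_trans leI (max_card _).
Qed.

End Counting.

Local Open Scope ring_scope.

Theorem theorem4 (n : nat) (G : sgraph) (order_G : #|G| = n) :
  let i := isolated_count G in
  let l := leaf_count G in
  let n2 := deg2_count G in
  let e2 := component_count G (complete 2) in
  let s := leaf_pair_count G in
  let m := leaf_deg2_edge_count G in
  let t22 := deg2_twin_count G in
  let p3 := component_count G (path_graph 3) in
  let c3 := component_count G (complete 3) in
  (dom_count G (n%:Z - 3))%:Z =
    'C(n, 3)%:Z
    - (i%:Z * 'C(n.-1, 2)%:Z + l%:Z * (n%:Z - 2) + n2%:Z)
    + ('C(i, 2)%:Z * (n%:Z - 2) + i%:Z * l%:Z + e2%:Z * (n%:Z - 2)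
       + s%:Z + m%:Z + t22%:Z)
    - ('C(i, 3)%:Z + i%:Z * e2%:Z + p3%:Z + c3%:Z).
Proof.
move=> i l n2 e2 s m t22 p3 c3; subst n.
(* Truncation in [#|G| - 2] is harmless because the factor [k] is 0 whenever it occurs. *)
have mul_order k : k = 0%N \/ (1 < #|G|)%N ->
    k%:Z * (#|G|%:Z - 2) = (k * (#|G| - 2))%N%:Z.
  by case=> [->|leG]; [rewrite mul0n GRing.mul0r|rewrite PoszM subzn].
rewrite !mul_order; [|exact: component_K2_order|exact: isolated_pairs_order
  |exact: leaf_count_order].
have := congr1 Posz (dom_count_nat G); rewrite -/i -/l -/n2 -/e2 -/s -/m -/t22 -/p3 -/c3.
rewrite -!PoszM -!PoszD; lia.
Qed.
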